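(* Let $h_1,\dots,h_P\in\mathbb{R}^M$ be the measurement vectors, with $\|h_p\|_2=1$ for all $p\in\mathcal{P}=\{1,\dots,P\}$ and $\sum_{p\in\mathcal{P}}h_ph_p^\top$ invertible, and let $s\ge0$ be an integer with $2s\le P$. For $\mathcal{A}\subseteq\mathcal{P}$ write $\mathcal{N}=\mathcal{P}\setminus\mathcal{A}$ and $\mathcal{G}_{\mathcal{N}}=\sum_{p\in\mathcal{N}}h_ph_p^\top$. (i) If $\lambda_{\min}(\mathcal{G}_{\mathcal{N}})>|\mathcal{A}|$ for all $\mathcal{A}\subseteq\mathcal{P}$ with $|\mathcal{A}|\le s$, then $\mathcal{P}$ is globally $2s$-sparse observable. (ii) Let $\mathcal{V}=\bigcup_{p\in\mathcal{P}}\{h_p\}$ be the set of all unique measurement vectors. If $\mathcal{V}$ is orthogonal and $\mathcal{P}$ is globally $2s$-sparse observable, then $\lambda_{\min}(\mathcal{G}_{\mathcal{N}})>|\mathcal{A}|$ for all $\mathcal{A}\subseteq\mathcal{P}$ with $|\mathcal{A}|\le s$.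
   Context: For an integer $0\le r\le P$, the set $\mathcal{P}$ of all measurement streams is globally $r$-sparse observable if the matrix $\mathcal{G}_{\mathcal{P}\setminus\mathcal{X}}=\sum_{p\in\mathcal{P}\setminus\mathcal{X}}h_ph_p^\top$ is invertible for all subsets $\mathcal{X}\subseteq\mathcal{P}$ of cardinality $|\mathcal{X}|=r$ (an empty sum is the zero matrix). A set of vectors $\{v_1,\dots,v_k\}$ (distinct elements) is orthogonal if $v_i^\top v_j=0$ for all $i\ne j$. $\lambda_{\min}$ denotes the smallest eigenvalue of a symmetric matrix. The $h_p$ need not be distinct for different $p$. *)

(* Defs.v *)
From mathcomp Require Import all_boot all_order all_algebra.
From mathcomp Require Import complex polyrcf.
From mathcomp Require Import mathcomp_extra boolp classical_sets reals.

Set Implicit Arguments.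
Unset Strict Implicit.
Unset Printing Implicit Defensive.

Import Order.TTheory GRing.Theory Num.Theory.

Local Open Scope ring_scope.

(* Euclidean norm; [`| v |] on matrices would be the sup norm. *)
Definition norm2 (R : realType) (M : nat) (v : 'cV[R]_M) : R :=
  Num.sqrt (\sum_(i < M) v i ord0 ^+ 2).

Definition gram (R : realType) (M P : nat) (h : 'I_P -> 'cV[R]_M)
    (N : {set 'I_P}) : 'M[R]_M :=
  \sum_(p in N) h p *m (h p)^T.

(* For symmetric A with M > 0 this infimum is attained, hence is the smallest
   eigenvalue: see [lambda_minP]. *)
Definition lambda_min (R : realType) (M : nat) (A : 'M[R]_M) : R :=
  inf [set a : R | eigenvalue A a]%classic.

(* Meant for r <= P only: for r > P it holds vacuously. *)
Definition globally_sparse_observable (R : realType) (M P : nat)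
    (h : 'I_P -> 'cV[R]_M) (r : nat) : Prop :=
  forall X : {set 'I_P}, #|X| = r -> gram h (~: X) \in unitmx.

Definition unique_vectors (R : realType) (M P : nat)
    (h : 'I_P -> 'cV[R]_M) : set 'cV[R]_M :=
  (\bigcup_(p in [set: 'I_P]) [set h p])%classic.

Definition orthogonal_set (R : realType) (M : nat) (V : set 'cV[R]_M) : Prop :=
  forall u v : 'cV[R]_M, V u -> V v -> u <> v -> u^T *m v = 0.

Lemma hermitian_eigenvalue_real (C : numClosedFieldType) (M : nat)
    (A : 'M[C]_M) (a : C) :
  map_mx Num.conj A^T = A -> eigenvalue A a -> a \is Num.real.
Proof.
move=> AH /eigenvalueP[v va v0].
pose w := map_mx Num.conj v^T.
have N0 : (v *m w) 0 0 != 0.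
  apply: contra v0 => /eqP; rewrite mxE => H; apply/eqP/rowP => j.
  have /psumr_eq0P : forall i : 'I_M, true -> 0 <= v 0 i * w i 0.
    by move=> i _; rewrite !mxE mul_conjC_ge0.
  move=> /(_ H) /(_ j isT) /eqP.
  by rewrite !mxE mul_conjC_eq0 => /eqP.
have cj (x : 'M[C]_1) : (map_mx Num.conj x^T) 0 0 = Num.conj (x 0 0).
  by rewrite !mxE.
have wt : map_mx Num.conj w^T = v by apply/matrixP=> i j; rewrite !mxE conjCK.
have E1 : v *m A *m w = a *: (v *m w) by rewrite va scalemxAl.
have E2 : map_mx Num.conj (v *m A *m w)^T = v *m A *m w.
  by rewrite !trmx_mul !map_mxM wt AH mulmxA.
have E3 : map_mx Num.conj (v *m w)^T = v *m w.
  by rewrite trmx_mul map_mxM wt.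
have := cj (v *m A *m w); rewrite E2 E1.
have -> : (a *: (v *m w)) 0 0 = a * (v *m w) 0 0 by rewrite mxE.
rewrite rmorphM /=; have := cj (v *m w); rewrite E3 => <-.
by move=> /(mulIf N0) E; rewrite CrealE -E.
Qed.

Lemma symmetric_eigenvalue (R : realType) (M : nat) (A : 'M[R]_M) :
  (0 < M)%N -> A^T = A -> exists a : R, eigenvalue A a.
Proof.
move=> M0 sA; pose AC := map_mx (real_complex R) A.
have AH : map_mx Num.conj AC^T = AC.
  by apply/matrixP=> i j; rewrite !mxE -[in RHS]sA mxE; apply: conjc_real.
have [a ea] := spectral.eigenvalue_closed AC M0.
have /complex_realP[k ak] := hermitian_eigenvalue_real AH ea; exists k.
move: ea; rewrite !eigenvalue_root_char ak.
by rewrite -map_char_poly fmorph_root.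
Qed.

Lemma lambda_minP (R : realType) (M : nat) (A : 'M[R]_M) :
  (0 < M)%N -> A^T = A ->
  eigenvalue A (lambda_min A) /\
  (forall a : R, eigenvalue A a -> lambda_min A <= a).
Proof.
move=> M0 sA; have [a0 ea0] := symmetric_eigenvalue M0 sA.
have p0 : char_poly A != 0 by rewrite monic_neq0 ?char_poly_monic.
pose s := sort <=%O (rootsR (char_poly A)).
have sE a : (a \in s) = eigenvalue A a.
  by rewrite mem_sort -(roots_on_rootsR p0) in_itv eigenvalue_root_char.
have : sorted <=%O s by apply: sort_sorted; exact: le_total.
case: s sE => [|m s] sE; first by have := sE a0; rewrite ea0.
move=> /= /(order_path_min le_trans) /allP ms.
have em : eigenvalue A m by rewrite -sE mem_head.
have lm a : eigenvalue A a -> m <= a.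
  by rewrite -sE inE => /predU1P[->//|/ms].
suff -> : lambda_min A = m by [].
apply/le_anti/andP; split.
  by apply: ge_inf => //; exists m => a /=; exact: lm.
by apply: lb_le_inf; [exists m | move=> a /=; exact: lm].
Qed.

(* Main.v *)
(** (i) Split a removed set X of size 2s into A and B of size s. If v kills the
    Gram matrix off X, then only B contributes to the form of the Gram matrix
    off A, so that form is at most s |v|^2 at v by Cauchy-Schwarz. The Rayleigh
    bound, from the spectral theorem over R[i], contradicts lambda_min > s.

    (ii) With orthogonal unit vectors, v G_N h_p is the number of q in N with
    h_q = h_p times v h_p. Hence each eigenvalue of G_N is such a multiplicity,
    as v h_p <> 0 for some p. Observability after removing 2s streams makes the
    multiplicity of h_p in the whole family exceed 2s: otherwise all copies of
    h_p could be removed, and h_p would be in the kernel. Removing A, with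
    |A| <= s, leaves more than s copies. *)
Require Import Defs.
From mathcomp Require Import all_boot all_order all_algebra.
From mathcomp Require Import classical_sets reals.
From mathcomp Require Import complex spectral sesquilinear zify ring.

Import Order.TTheory GRing.Theory Num.Theory.

Local Open Scope ring_scope.

(** In the coordinates [w] of [v] on a unitary eigenbasis, the rows of [Q], both forms are sums of
    |w_i|^2, weighted by [l] on one side and by the eigenvalues of [A] on the other. *)
Lemma hermitian_form_ge {C : numClosedFieldType} {n : nat} {A : 'M[C]_n} {l : C}
    (v : 'rV[C]_n) :
  A \is hermsymmx -> (forall a : C, eigenvalue A a -> l <= a) ->
  l * (v *m (map_mx Num.conj v^T)) 0 0 <=
    (v *m A *m (map_mx Num.conj v^T)) 0 0.
Proof.
move=> /hermitian_normalmx /orthomx_spectralP; set Q := spectralmx A.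
set d := spectral_diag A => AE lA.
have Qu : Q \is unitarymx by exact: spectral_unitarymx.
have Quu := unitarymx_unit Qu.
pose w := v *m invmx Q.
have wE : map_mx Num.conj w^T = Q *m map_mx Num.conj v^T.
  by rewrite /w invmx_unitary // trmx_mul map_mxM -[in RHS](trmxCK Q).
have -> : v *m map_mx Num.conj v^T = w *m map_mx Num.conj w^T.
  by rewrite wE /w mulmxA mulmxKV.
have -> : v *m A *m map_mx Num.conj v^T
    = w *m diag_mx d *m map_mx Num.conj w^T.
  by rewrite wE /w [in LHS]AE !mulmxA.
rewrite mul_mx_diag !mxE mulr_sumr ler_sum // => i _.
rewrite [w]lock !mxE mulrAC [leRHS]mulrC ler_wpM2r ?mul_conjC_ge0 //.
apply: lA.
apply/eigenvalueP; exists (row i Q).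
  rewrite -row_mul [in LHS]AE !mulmxA mulmxV // mul1mx row_mul row_diag_mx.
  by rewrite -scalemxAl -rowE.
apply: contraTneq isT => Qi0.
have := mulmxV Quu => /(congr1 (row i)); rewrite row_mul Qi0 mul0mx.
by move=> /rowP /(_ i) /eqP; rewrite !mxE eqxx eq_sym oner_eq0.
Qed.

(** The Rayleigh bound, obtained over R[i]: the eigenvalues of the complexified matrix are real
    roots of the same characteristic polynomial, hence at least [lambda_min A]. *)
Lemma lambda_min_form {R : realType} {n : nat} {A : 'M[R]_n} (v : 'rV[R]_n) :
  (0 < n)%N -> A^T = A ->
  lambda_min A * (v *m v^T) 0 0 <= (v *m A *m v^T) 0 0.
Proof.
move=> n0 sA; have [_ minA] := lambda_minP n0 sA.
pose AC := map_mx (real_complex R) A.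
have AH : map_mx Num.conj AC^T = AC.
  by apply/matrixP=> i j; rewrite !mxE -[in RHS]sA mxE; apply: conjc_real.
have AHs : AC \is hermsymmx by rewrite is_hermitianmxE expr0 scale1r AH.
have lAC a : eigenvalue AC a -> (lambda_min A)%:C%C <= a.
  move=> ea; have /complex_realP[k ak] := hermitian_eigenvalue_real AH ea.
  rewrite ak lecR; apply: minA; move: ea; rewrite !eigenvalue_root_char ak.
  by rewrite -map_char_poly fmorph_root.
have := hermitian_form_ge (map_mx (real_complex R) v) AHs lAC.
have -> : map_mx Num.conj (map_mx (real_complex R) v)^T
    = map_mx (real_complex R) v^T.
  by apply/matrixP=> i j; rewrite !mxE; apply: conjc_real.
have mapE (B : 'M[R]_1) : map_mx (real_complex R) B 0 0 = (B 0 0)%:C%C.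
  by rewrite mxE.
by rewrite -!map_mxM !mapE -(rmorphM (real_complex R)) lecR.
Qed.

(** The [k]-subsets of [B] are counted by a binomial coefficient, positive here. *)
Lemma subset_of_card {T : finType} {B : {set T}} {k : nat} :
  (k <= #|B|)%N -> exists2 A : {set T}, A \subset B & #|A| = k.
Proof.
rewrite -bin_gt0 -cards_draws card_gt0 => /finset.set0Pn[A].
by rewrite inE => /andP[AB /eqP]; exists A.
Qed.

Section Gram.
Context {R : realType} {M P : nat} {h : 'I_P -> 'cV[R]_M}.
Implicit Types (N : {set 'I_P}) (v : 'rV[R]_M).

Lemma gram_sym N : (gram h N)^T = gram h N.
Proof.
by rewrite /gram raddf_sum; apply: eq_bigr => p _; rewrite /= trmx_mul trmxK.
Qed.

Lemma mul_gram v N :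
  v *m gram h N = \sum_(p in N) (v *m h p) 0 0 *: (h p)^T.
Proof.
rewrite /gram mulmx_sumr; apply: eq_bigr => p _.
by rewrite mulmxA {1}[v *m h p]mx11_scalar mul_scalar_mx.
Qed.

Lemma gram_form v N :
  (v *m gram h N *m v^T) 0 0 = \sum_(p in N) (v *m h p) 0 0 ^+ 2.
Proof.
rewrite mul_gram mulmx_suml summxE; apply: eq_bigr => p _.
by rewrite -scalemxAl -trmx_mul !mxE expr2.
Qed.

Lemma gram_singularP N :
  reflect (exists2 v : 'rV[R]_M, v != 0 & v *m gram h N = 0)
    (gram h N \notin unitmx).
Proof.
apply: (iffP idP) => [|[v v0 vG]].
  rewrite -row_free_unit -kermx_eq0 => /rowV0Pn[v /sub_kermxP vG v0].
  by exists v.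
by apply: contra v0 => Gu; rewrite -(mulmxK Gu v) vG mul0mx.
Qed.

Lemma mul_row_tr_gt0 v : v != 0 -> 0 < (v *m v^T) 0 0.
Proof.
move=> v0; rewrite lt_def; have sq i : 0 <= v 0 i * v^T i 0.
  by rewrite mxE -expr2 sqr_ge0.
rewrite mxE sumr_ge0 // andbT; apply: contra v0.
rewrite psumr_eq0 // => /allP z; apply/eqP/rowP => i.
by have := z i (mem_index_enum _); rewrite !mxE mulf_eq0 orbb => /eqP.
Qed.

Hypothesis h_unit : forall p : 'I_P, norm2 (h p) = 1.

Lemma norm2_unit p : ((h p)^T *m h p) 0 0 = 1.
Proof.
rewrite mxE -[RHS](expr1n _ 2) -(h_unit p) sqr_sqrtr.
  by apply: eq_bigr => i _; rewrite mxE expr2.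
by apply: sumr_ge0 => i _; rewrite sqr_ge0.
Qed.

Lemma sqr_mul_unit_le v p : (v *m h p) 0 0 ^+ 2 <= (v *m v^T) 0 0.
Proof.
set c := (v *m h p) 0 0.
have cE : ((h p)^T *m v^T) 0 0 = c by rewrite -trmx_mul mxE.
(* The component of [v] orthogonal to [h p]; its squared norm |v|^2 - c^2 is nonnegative. *)
pose w := v - c *: (h p)^T.
have : 0 <= (w *m w^T) 0 0.
  by have [->|/mul_row_tr_gt0/ltW//] := eqVneq w 0; rewrite mul0mx mxE.
have -> : (w *m w^T) 0 0 = (v *m v^T) 0 0 - c ^+ 2.
  have -> : w^T = v^T - c *: h p by rewrite raddfB /= linearZ /= trmxK.
  rewrite /w mulmxBl !mulmxBr -!scalemxAl -!scalemxAr.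
  have -> : (h p)^T *m h p = 1%:M.
    by rewrite [LHS]mx11_scalar norm2_unit.
  rewrite [v *m h p]mx11_scalar [(h p)^T *m v^T]mx11_scalar cE -/c.
  move: (v *m v^T) => B; rewrite !mxE eqxx !mulr1n; ring.
by rewrite subr_ge0.
Qed.

Lemma gram_form_le_card v N :
  (v *m gram h N *m v^T) 0 0 <= #|N|%:R * (v *m v^T) 0 0.
Proof.
rewrite gram_form mulr_natl -sumr_const ler_sum // => p _.
exact: sqr_mul_unit_le.
Qed.

Lemma sparse_observable_of_lambda_min s :
  (0 < M)%N ->
  (forall A : {set 'I_P}, (#|A| <= s)%N ->
     #|A|%:R < lambda_min (gram h (~: A))) ->
  globally_sparse_observable h (2 * s).
Proof.
move=> M0 lamA X cX; apply/contraT => /gram_singularP[v v0 vX].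
have [|A AX cA] := @subset_of_card _ X s.
  by rewrite cX mul2n -addnn leq_addr.
have cXA : #|X :\: A| = s.
  by rewrite cardsDS // cX cA mul2n -addnn addnK.
(* As [A] lies in [X], its complement is the disjoint union of [~: X] and [X :\: A]. *)
have split_gram : gram h (~: A) = gram h (~: X) + gram h (X :\: A).
  rewrite /gram -bigU /=; last first.
    rewrite disjoint_subset; apply/fintype.subsetP => p.
    by rewrite !inE => /negPf->; rewrite andbF.
  apply: eq_bigl => p; rewrite !inE; have := fintype.subsetP AX p.
  by case: (p \in A) => [-> //|_]; case: (p \in X).
have := lambda_min_form v M0 (gram_sym (~: A)).
rewrite {2}split_gram mulmxDr vX add0r.
move=> /le_trans /(_ (gram_form_le_card _ _)).
(* Cancelling |v|^2 > 0 leaves [lambda_min] at most s = |A|, against the hypothesis for [A]. *)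
by rewrite cXA ler_pM2r ?mul_row_tr_gt0 // leNgt -cA lamA // cA.
Qed.

Lemma class_card_gt {r} p :
  (r <= P)%N -> orthogonal_set (unique_vectors h) ->
  globally_sparse_observable h r -> (r < #|[set q | h q == h p]|)%N.
Proof.
move=> rP orth obs; rewrite ltnNge; apply/negP => cr.
set C := [set q | h q == h p] in cr *.
(* Observability speaks of removed sets of size exactly [r], so [C] is enlarged to such a set, the
   complement of [N]. *)
have [|N NC cN] := @subset_of_card _ (~: C) (P - r).
  by rewrite cardsCs finset.setCK card_ord leq_sub2l.
have := obs (~: N).
rewrite cardsCs finset.setCK cN card_ord subKn // => /(_ erefl).
apply/negP/gram_singularP; exists (h p)^T.
  apply: contraTneq (oner_neq0 R) => hp0.
  by rewrite -(norm2_unit p) hp0 mul0mx mxE eqxx.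
rewrite mul_gram big1 // => q /(fintype.subsetP NC); rewrite !inE => /eqP qp.
rewrite orth ?mxE ?scale0r //; [by exists p | by exists q | exact: nesym].
Qed.

Lemma eigenvalue_gramE {N} {a : R} :
  gram h [set: 'I_P]%SET \in unitmx -> orthogonal_set (unique_vectors h) ->
  eigenvalue (gram h N) a ->
  exists p, a = #|[set q in N | h q == h p]|%:R.
Proof.
move=> obs orth /eigenvalueP[v va v0].
(* A [v] orthogonal to every [h p] would lie in the kernel of the full Gram matrix. *)
have [p vp] : exists p, (v *m h p) 0 0 != 0.
  apply/existsP; apply: contraTT obs; rewrite negb_exists => /forallP z.
  apply/gram_singularP; exists v => //; rewrite mul_gram big1 // => p _.
  by have := z p; rewrite negbK => /eqP ->; rewrite scale0r.
exists p; apply: (mulIf vp).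
(* The product v G_N h_p is evaluated twice: by the eigenvalue equation, and as a sum in which [q]
   contributes v h_p if h_q = h_p and 0 otherwise. *)
have -> : a * (v *m h p) 0 0 = (v *m gram h N *m h p) 0 0.
  by rewrite va -scalemxAl [RHS]mxE.
rewrite mul_gram mulmx_suml summxE mulr_natl -sumr_const.
rewrite [RHS]big_mkcond [LHS]big_mkcond; apply: eq_bigr => q _; rewrite inE.
case: (q \in N) => //=; rewrite -scalemxAl mxE.
have [->|/eqP qp] := eqVneq (h q) (h p); first by rewrite norm2_unit mulr1.
by rewrite orth ?mxE ?mulr0 //; [exists q | exists p].
Qed.

Lemma lambda_min_gt_of_sparse_observable s (A : {set 'I_P}) :
  (0 < M)%N -> gram h [set: 'I_P]%SET \in unitmx -> (2 * s <= P)%N ->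
  orthogonal_set (unique_vectors h) -> globally_sparse_observable h (2 * s) ->
  (#|A| <= s)%N -> #|A|%:R < lambda_min (gram h (~: A)).
Proof.
move=> M0 obs sP orth sobs As.
(* The minimum is itself an eigenvalue, so it counts the copies of some h_p outside [A]. *)
have [/(eigenvalue_gramE obs orth)[p ->] _] :=
  lambda_minP M0 (gram_sym (~: A)).
rewrite ltr_nat; have := class_card_gt p sP orth sobs.
set C := [set q | h q == h p] => cC.
have -> : [set q in ~: A | h q == h p] = C :\: A.
  by apply/finset.setP => q; rewrite !inE.
(* |C :\: A| >= |C| - |A| > 2s - s >= |A|. *)
have := cardsID A C; have := subset_leq_card (finset.subsetIr C A).
by move: As cC; move: #|C :&: A| #|C :\: A| #|C| #|A| => *; lia.
Qed.

End Gram.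

Theorem theorem2 (R : realType) (M P : nat) (h : 'I_P -> 'cV[R]_M) (s : nat)
    (M_gt0 : (0 < M)%N)
    (h_unit : forall p : 'I_P, norm2 (h p) = 1)
    (h_obs : gram h [set: 'I_P]%SET \in unitmx)
    (s_le : (2 * s <= P)%N) :
  ((forall A : {set 'I_P}, (#|A| <= s)%N ->
      #|A|%:R < lambda_min (gram h (~: A))) ->
   globally_sparse_observable h (2 * s))
  /\
  (orthogonal_set (unique_vectors h) ->
   globally_sparse_observable h (2 * s) ->
   forall A : {set 'I_P}, (#|A| <= s)%N ->
     #|A|%:R < lambda_min (gram h (~: A))).
Proof.
split; first exact: sparse_observable_of_lambda_min.
by move=> orth obs A; apply: lambda_min_gt_of_sparse_observable.
Qed.
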